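(* Let $p_c$ be the percolation threshold of directed bond-percolation in $\mathbb{N}^2$, and let $\alpha\in(0,1)$. If $\alpha\geq\sqrt[3]{1-(1-p_c)^4}$, then $\mathrm{Majority}(\alpha)$ has several invariant measures, and, respectively, $\mathrm{FINAE}(\alpha)$ has invariant measures other than the convex combinations of $\delta_{0^{\mathbb{Z}}}$ and $\delta_{1^{\mathbb{Z}}}$. This is in particular the case if $\alpha\geq 0.996$.
   Context: PCA on $\mathbb{Z}$ with alphabet $\{0,1\}$ and neighborhood $V=\{-1,0,1\}$. Given a transition function $f:\{0,1\}^3\to\mathcal{M}(\{0,1\})$ ($\mathcal{M}$ = probability measures), the associated probabilistic cellular automaton is the map $\mu\mapsto\mu P$ on probability measures on $\{0,1\}^{\mathbb{Z}}$ such that for all finite $K\subset\mathbb{Z}$ and $y_K\in\{0,1\}^K$ (identified with the cylinder $\{x:x_k=y_k\ \forall k\in K\}$), $$\mu P(y_K)=\sum_{x_{V+K}\in\{0,1\}^{V+K}}\mu(x_{V+K})\prod_{k\in K}f(x_{k-1},x_k,x_{k+1})(y_k),\qquad V+K=\{v+k:v\in V,k\in K\}.$$ A probability measure $\pi$ is invariant if $\pi P=\pi$. $\mathrm{Majority}(\alpha)$ has transition function $f(x,y,z)=\alpha\,\delta_{\mathrm{maj}(x,y,z)}+(1-\alpha)\,\delta_{1-y}$, where $\mathrm{maj}(x,y,z)$ is the value taken by at least two of $x,y,z$. $\mathrm{FINAE}(\alpha)$ (''flip-if-not-all-equal'') has transition function $g(x,y,z)=\alpha\,\delta_{h(x,y,z)}+(1-\alpha)\,\delta_y$,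 where $h(x,y,z)=y$ if $x=y=z$ and $h(x,y,z)=1-y$ otherwise. $\delta_{a^{\mathbb{Z}}}$ is the Dirac mass at the configuration with all cells equal to $a$. Directed bond-percolation in $\mathbb{N}^2$: each arc from $(i,j)$ to $(i+1,j)$ and from $(i,j)$ to $(i,j+1)$ is open independently with probability $p$; $p_c$ is the supremum of the $p\in[0,1]$ for which almost surely there is no infinite directed open path from the origin. It is known that $0.6298\le p_c\le 2/3$. *)

(* Defs.v *)
From HB Require Import structures.
From mathcomp Require Import all_boot all_order all_algebra finmap.
From mathcomp Require Import all_classical all_reals all_analysis.

Set Implicit Arguments.
Unset Strict Implicit.
Unset Printing Implicit Defensive.
Import Order.TTheory GRing.Theory Num.Theory.

Local Open Scope classical_set_scope.
Local Open Scope ring_scope.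

Section Configurations.
Variable I : choiceType.

(* The cylinder of y_K only depends on the values of y on K. *)
Definition cylinder (K : {fset I}) (y : I -> bool) : set (I -> bool) :=
  [set x | forall k, k \in K -> x k = y k].

Definition cylinders : set (set (I -> bool)) :=
  [set C | exists K y, C = cylinder K y].

(* {0,1}^I with the product sigma-algebra, 1 being encoded by true. *)
Definition config := g_sigma_algebraType cylinders.

(* An element of {0,1}^K, extended to I by an arbitrary value. *)
Definition extend (K : {fset I}) (y : {ffun K -> bool}) : I -> bool :=
  fun i => if insub i is Some k then y k else false.

End Configurations.

Section Mixture.
Context d (T : measurableType d) (R : realType).
Variables (t : {i01 R}) (mu nu : probability T R).

Definition mixture : set T -> \bar R :=
  measure_add (mscale t%:num%:nng mu) (mscale (1 - t%:num)%:nng nu).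

Lemma mixtureE A :
  mixture A = (t%:num%:E * mu A + (1 - t%:num)%:E * nu A)%E.
Proof. by rewrite /mixture measure_addE. Qed.

HB.instance Definition _ := Measure.on mixture.

Let mixture_setT : mixture [set: T] = 1%E.
Proof. by rewrite mixtureE !probability_setT !mule1 -EFinD subrKC. Qed.

HB.instance Definition _ := Measure_isProbability.Build _ _ _ mixture mixture_setT.

End Mixture.

Section PCA.
Variable R : realType.

Definition transition := bool -> bool -> bool -> probability bool R.

Definition neighborhood : {fset int} := [fset -1; 0; 1]%fset.

Definition enlarge (K : {fset int}) : {fset int} :=
  [fset (v + k)%R | v in neighborhood, k in K]%fset.

(* nu = mu P, where P is the PCA of transition function f; the cylinders form
   a pi-system generating the sigma-algebra, so nu is determined by mu. *)
Definition is_image (f : transition) (mu nu : probability (config int) R) :=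
  forall (K : {fset int}) (y : int -> bool),
    nu (cylinder K y) =
    (\sum_(z : {ffun enlarge K -> bool})
       let x := extend z in
       mu (cylinder (enlarge K) x) *
       \prod_(k <- K) f (x (k - 1)%R) (x k) (x (k + 1)%R) [set y k])%E.

Definition invariant_measure (f : transition) (pi : probability (config int) R) :=
  is_image f pi pi.

Definition maj (x y z : bool) : bool := [|| x && y, y && z | x && z].

Definition Majority (alpha : {i01 R}) : transition :=
  fun x y z => mixture alpha \d_(maj x y z) \d_(~~ y).

Definition flip_if_not_all_equal (x y z : bool) : bool :=
  if (x == y) && (y == z) then y else ~~ y.

Definition FINAE (alpha : {i01 R}) : transition :=
  fun x y z => mixture alpha \d_(flip_if_not_all_equal x y z) \d_y.

Definition several_invariant_measures (f : transition) :=
  exists pi1 pi2 : probability (config int) R,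
    [/\ invariant_measure f pi1, invariant_measure f pi2 &
        exists2 A, measurable A & pi1 A <> pi2 A].

Definition monochromatic (a : bool) : config int := fun=> a.

Definition convex_combination_of_monochromatic
    (pi : probability (config int) R) :=
  exists t : {i01 R}, forall A, measurable A ->
    pi A = mixture t \d_(monochromatic false) \d_(monochromatic true) A.

Definition nontrivial_invariant_measure (f : transition) :=
  exists2 pi : probability (config int) R,
    invariant_measure f pi & ~ convex_combination_of_monochromatic pi.

End PCA.

Section DirectedPercolation.

(* An arc is given by its source and its direction: true for the arc from
   (i, j) to (i + 1, j), false for the arc from (i, j) to (i, j + 1). *)
Definition grid_arc : choiceType := ((nat * nat) * bool)%type.

Definition target (e : grid_arc) : nat * nat :=
  let: ((i, j), b) := e in if b then (i.+1, j) else (i, j.+1).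

Definition infinite_open_path (w : config grid_arc) : Prop :=
  exists gamma : nat -> nat * nat, gamma 0%N = (0%N, 0%N) /\
    forall n, exists b : bool,
      w (gamma n, b) /\ gamma n.+1 = target (gamma n, b).

Variable R : realType.

(* mu is the law under which the arcs are open (true) independently with
   probability p. Such a mu exists and is unique for every p in [0, 1]. *)
Definition iid_bernoulli (p : R) (mu : probability (config grid_arc) R) :=
  forall (K : {fset grid_arc}) (y : grid_arc -> bool),
    mu (cylinder K y) = (\prod_(e <- K) bernoulli_prob p [set y e])%E.

Definition no_percolation (p : R) :=
  forall mu : probability (config grid_arc) R, iid_bernoulli p mu ->
    {ae mu, forall w, ~ infinite_open_path w}.

Definition pc : R := sup [set p | 0 <= p <= 1 /\ no_percolation p].

End DirectedPercolation.

(* Main.v *)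
(* Majority and FINAE are handled together: in the coordinates that add the
   parity of the cell, a step of Majority is a step of FINAE followed by a global
   flip. Cesaro averages of the dynamics, taken along an ultrafilter, yield
   invariant measures, and it is enough to bound, uniformly in time, the
   probability that FINAE started from ...0101... shows five equal cells.

   Call a cell dead if it agrees with both neighbours. Seen backward in time, a
   maximal run of dead cells grows by one cell on each side unless a coin of
   bias [alpha] fails, and dead runs separated by a live cell stay separated.
   Hence the runs perform a branching recursion backward in time which has to
   die out at time 0, and its generating function stays bounded as soon as
   [1 - alpha <= 1 / 45]. This is a Peierls estimate that does not go through
   percolation: of the threshold one only needs [1 / 2 <= pc], which follows
   from counting paths and gives [alpha ^ 3 >= 15 / 16]. *)

From HB Require Import structures.
Require Import Defs.
From mathcomp Require Import all_boot all_order all_algebra finmap.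
From mathcomp Require Import all_classical all_reals all_analysis.
From mathcomp Require Import ring lra zify.
Import Order.TTheory GRing.Theory Num.Theory.
Import numFieldNormedType.Exports.
Local Open Scope ring_scope.
Set Implicit Arguments.
Unset Strict Implicit.
Unset Printing Implicit Defensive.

(** * Words of labels and their generating function *)

(* What a cell of a block shows at time [t], given that the whole block shows the
   colour [c] at time [t + 1]: [None] if the cell and its neighbours have colour
   [c], [Some true] if it is another cell of colour [c] (its coin failed), and
   [Some false] if it has the other colour (it flipped). *)
Definition symbol := option bool.

Fixpoint words (N : nat) : seq (seq symbol) :=
  if N is N'.+1
  then [seq s :: v | s <- [:: None; Some true; Some false], v <- words N']
  else [:: [::]].

(* [j] and [m] are the lengths of the runs of [Some false] and of [None] that end
   just before the word. *)
Fixpoint admissible (j m : nat) (v : seq symbol) : bool :=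
  match v with
  | [::] => true
  | None :: v' => (j == 0)%N && admissible 0 m.+1 v'
  | Some true :: v' => admissible 0 0 v'
  | Some false :: v' => [&& (m == 0)%N, (j < 2)%N & admissible j.+1 0 v']
  end.

(* The pair [(p, m)] stands for the interval of cells [[p, p + m[]. *)
Definition close_run (m : nat) (p : int) : seq (int * nat) :=
  if m is 0 then [::] else [:: (p - m%:Z, m)].

Fixpoint runs (m : nat) (p : int) (v : seq symbol) : seq (int * nat) :=
  match v with
  | [::] => close_run m p
  | None :: v' => runs m.+1 (p + 1) v'
  | Some _ :: v' => close_run m p ++ runs 0 (p + 1) v'
  end.

Definition nfail (v : seq symbol) : nat := count_mem (Some true) v.

Section Weights.
Variables (R : realFieldType) (eps : R).
Hypothesis eps_ge0 : 0 <= eps.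

Definition run_weight (f : nat -> R) (m : nat) : R := if m is 0 then 1 else f m.

Fixpoint word_weight (f : nat -> R) (j m : nat) (v : seq symbol) : R :=
  match v with
  | [::] => run_weight f m
  | None :: v' => if (j == 0)%N then word_weight f 0 m.+1 v' else 0
  | Some true :: v' => run_weight f m * eps * word_weight f 0 0 v'
  | Some false :: v' =>
      if (m == 0)%N && (j < 2)%N then word_weight f j.+1 0 v' else 0
  end.

Lemma word_weight_ge0 f j m v : (forall n, 0 <= f n) -> 0 <= word_weight f j m v.
Proof.
move=> f0; have g0 k : 0 <= run_weight f k by case: k => [|k] /=.
elim: v j m => [|[[]|] v IHv] j m //=.
- by rewrite !mulr_ge0.
- by case: ifP.
- by case: ifP.
Qed.

Lemma word_weight_admissible f j m p v : admissible j m v ->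
  word_weight f j m v = eps ^+ nfail v * \prod_(r <- runs m p v) f r.2.
Proof.
have close q k : \prod_(r <- close_run k q) f r.2 = run_weight f k.
  by case: k => [|k]; [exact: big_nil | exact: big_seq1].
elim: v j m p => [|[[]|] v IHv] j m p /=.
- by rewrite /nfail /= expr0 mul1r close.
- move=> h; rewrite (IHv _ _ (p + 1) h) big_cat /= close /nfail /= exprS; ring.
- case/and3P => /eqP -> j2 h; rewrite j2 /=; rewrite (IHv _ _ (p + 1) h).
  by [].
- by case/andP => /eqP -> h; rewrite (IHv _ _ (p + 1) h) eqxx.
Qed.

Definition total (f : nat -> R) (j m N : nat) : R :=
  \sum_(v <- words N) word_weight f j m v.

Lemma total0 f j m : total f j m 0 = run_weight f m.
Proof. by rewrite /total big_seq1. Qed.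

Lemma totalS f j m N : total f j m N.+1 =
  (if (j == 0)%N then total f 0 m.+1 N else 0) +
  run_weight f m * eps * total f 0 0 N +
  (if (m == 0)%N && (j < 2)%N then total f j.+1 0 N else 0).
Proof.
rewrite /total /= cats0 !big_cat /= !big_map -addrA; congr (_ + (_ + _)).
- by rewrite /=; case: ifP => // _; exact: big1.
- by rewrite big_distrr.
- by rewrite /=; case: ifP => // _; exact: big1.
Qed.

Lemma total_ge0 f j m N : (forall n, 0 <= f n) -> 0 <= total f j m N.
Proof. by move=> f0; apply: sumr_ge0 => v _; apply: word_weight_ge0. Qed.

(** A truncation of the generating function of [u] at 2. All later estimates are uniform in [M],
    which replaces convergence of the series. *)
Definition psum (M : nat) (u : nat -> R) : R := \sum_(N < M) 2 ^+ N * u N.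

Lemma psumS M u : psum M.+1 u = u 0%N + 2 * psum M (fun n => u n.+1).
Proof.
rewrite /psum big_ord_recl expr0 mul1r big_distrr; congr (_ + _).
by apply: eq_bigr => i _; rewrite lift0 exprS -mulrA.
Qed.

Lemma psum_ge0 M u : (forall n, 0 <= u n) -> 0 <= psum M u.
Proof. by move=> u0; apply: sumr_ge0 => i _; rewrite mulr_ge0 ?exprn_ge0. Qed.

Lemma psum_le M u : (forall n, 0 <= u n) -> psum M u <= psum M.+1 u.
Proof.
by move=> u0; rewrite /psum big_ord_recr lerDl mulr_ge0 ?exprn_ge0.
Qed.

(** The open run goes on for some [n] further cells; then the word stops, or one failed coin (cost
    [eps], one letter, hence the factor [2 * eps]) is followed by a fresh word. The product of the
    truncated series dominates the truncated product. *)
Lemma psum_run f m M : (forall n, 0 <= f n) ->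
  psum M (total f 0 m.+1) <=
  psum M (fun n => f (m + n).+1) * (1 + 2 * eps * psum M (total f 0 0)).
Proof.
move=> f0; elim: M m => [|M IHM] m; first by rewrite /psum !big_ord0 mul0r.
have a0 n : 0 <= total f 0 0 n by apply: total_ge0.
rewrite psumS total0 /=.
under [X in psum M X]eq_fun do rewrite totalS /= addr0.
set C := psum M.+1 (total f 0 0); pose C' := psum M (total f 0 0).
have C'C : C' <= C by apply: psum_le.
have C'0 : 0 <= C' by apply: psum_ge0.
have -> : psum M (fun x => total f 0 m.+2 x + f m.+1 * eps * total f 0 0 x) =
    psum M (total f 0 m.+2) + f m.+1 * eps * C'.
  rewrite /psum /C' mulr_sumr -big_split; apply: eq_bigr => i _; rewrite /=; ring.
rewrite psumS addn0.
have -> : psum M (fun n => f (m + n.+1).+1) = psum M (fun n => f (m.+1 + n).+1).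
  by apply: eq_bigr => i _; rewrite addnS.
have /= := IHM m.+1; rewrite -/C'; set P := psum M (fun n => f _); set Q := psum _ _.
have P0 : 0 <= P by apply: psum_ge0.
have := f0 m.+1; have h : eps * C' <= eps * C by apply: ler_wpM2l.
have : P * (1 + 2 * eps * C') <= P * (1 + 2 * eps * C).
  by apply: ler_wpM2l => //; lra.
move=> h1 fm h2; have : f m.+1 * (eps * C') <= f m.+1 * (eps * C) by apply: ler_wpM2l.
lra.
Qed.

Hypothesis eps_le : eps <= 1 / 45.

(* Let [a] and [F] be the generating functions, at 2, of [total f 0 0] and of
   the run weights [f]. The recursion reads [a = (7 + F) (1 + 2 eps a)], so that
   [F <= 3] gives [a <= 19]; then [(19 - 7) / 4 = 3] reproduces the bound on [F].
   As [psum] starts at index 0, [F <= 3] appears as a bound by [3 / 2]. *)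
Lemma psum_total f : (forall n, 0 <= f n) ->
  (forall M, psum M (fun n => f n.+1) <= 3 / 2) ->
  forall M, psum M (total f 0 0) <= 19.
Proof.
move=> f0 F; elim=> [|M IHM]; first by rewrite /psum big_ord0.
have a0 n : 0 <= total f 0 0 n by apply: total_ge0.
(* Recursion on the first letter: [Some true] restarts the word at cost [eps], where the induction
   hypothesis 19 applies, and [v] collects the other continuations. *)
have step u v w : (forall n, u n.+1 = eps * total f 0 0 n + v n) -> u 0%N = 1 ->
    (forall n, 0 <= v n) -> psum M v <= w ->
    forall M', (M' <= M)%N -> psum M' u <= 1 + 2 * eps * 19 + 2 * w.
  move=> uE u1 v0 vw [|M'] ltM.
    rewrite /psum big_ord0; have := eps_ge0.
    have : 0 <= w by apply: le_trans vw; apply: psum_ge0.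
    lra.
  rewrite psumS u1; under [X in psum M' X]eq_fun do rewrite uE.
  have -> : psum M' (fun n => eps * total f 0 0 n + v n) =
      eps * psum M' (total f 0 0) + psum M' v.
    rewrite /psum mulr_sumr -big_split; apply: eq_bigr => i _; rewrite /=; ring.
  have mono z : (forall n, 0 <= z n) -> psum M' z <= psum M z.
    move=> z0; have := ltnW ltM; elim: (M) => [|k IHk]; first by rewrite leqn0 => /eqP ->.
    rewrite leq_eqVlt => /orP[/eqP -> //|]; rewrite ltnS => /IHk h.
    exact: le_trans h (psum_le _ _).
  have h1 := mono _ a0; have h2 := mono _ v0.
  have : eps * psum M' (total f 0 0) <= eps * 19.
    by apply: ler_wpM2l => //; apply: le_trans IHM.
  lra.
have x2 : psum M (total f 2 0) <= 1 + 2 * eps * 19.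
  rewrite -[leRHS]addr0 -[X in _ <= _ + X](mulr0 2); apply: (step _ (fun=> 0)) => //.
  - by move=> n; rewrite totalS /= mul1r add0r.
  - exact: total0.
  - by rewrite /psum big1 // => i _; rewrite mulr0.
have x1 : psum M (total f 1 0) <= 1 + 2 * eps * 19 + 2 * (1 + 2 * eps * 19).
  apply: step x2 _ _ => //.
  - by move=> n; rewrite totalS /= mul1r add0r.
  - exact: total0.
  - by move=> n; apply: total_ge0.
rewrite psumS total0 /=; under [X in psum M X]eq_fun do rewrite totalS /= mul1r.
have -> : psum M (fun n => total f 0 1 n + eps * total f 0 0 n + total f 1 0 n) =
    psum M (total f 0 1) + eps * psum M (total f 0 0) + psum M (total f 1 0).
  rewrite /psum mulr_sumr -!big_split; apply: eq_bigr => i _; rewrite /=; ring.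
have i1 := psum_run 0 M f0.
have := F M; set P := psum M _ => PF.
have P0 : 0 <= P by apply: psum_ge0.
have C0 : 0 <= psum M (total f 0 0) by apply: psum_ge0.
have ea : eps * psum M (total f 0 0) <= eps * 19 by apply: ler_wpM2l.
have h : P * (1 + 2 * eps * psum M (total f 0 0)) <= 3 / 2 * (1 + 2 * eps * 19).
  have := mulr_ge0 eps_ge0 C0 => ea0.
  by apply: ler_pM => //; lra.
have := le_trans i1 h; have := eps_le.
lra.
Qed.

(** Will bound the probability that a given run of [n] cells is dead at time [t]. The length [n.+2]
    is that of the run with its two neighbours, whose labels are summed over. *)
Fixpoint run_bound (t : nat) : nat -> R :=
  if t is t'.+1 then fun n => total (run_bound t') 0 0 n.+2 else fun=> 0.

Lemma run_bound_ge0 t n : 0 <= run_bound t n.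
Proof. by elim: t n => [|t IHt] n //=; apply: total_ge0. Qed.

Lemma psum_run_bound t M : psum M (fun n => run_bound t n.+1) <= 3 / 2.
Proof.
elim: t M => [|t IHt] M.
  by rewrite /psum big1 => [|i _]; rewrite ?mulr0; lra.
have f0 := run_bound_ge0 t; set f := run_bound t in f0 IHt *.
have /= := psum_total f0 IHt M.+3.
have a0 j m n : 0 <= total f j m n by apply: total_ge0.
rewrite !psumS total0; set P := psum M _ => h.
(* Words of at most two letters [Some false] weigh 1, so the terms 0, 1, 2 take at least 1 + 2 + 4 =
   7 of the 19. The remaining 12 bounds [8 * P]. *)
have ge n j : (j < 2)%N -> total f j.+1 0 n <= total f j 0 n.+1.
  move=> j2; rewrite [leRHS]totalS j2 lerDr addr_ge0 //.
    by case: ifP.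
  by rewrite !mulr_ge0.
have := ge 0%N 0%N isT; rewrite total0 /= => a1.
have := le_trans (ge 0%N 1%N isT) (ge 1%N 0%N isT); rewrite total0 /= => a2.
rewrite -[leLHS]/P; move: a1 a2 h; rewrite /=; lra.
Qed.

End Weights.
(** * Dead runs and their backward evolution *)

Definition cells (p : int) (n : nat) : seq int := [seq p + i%:Z | i <- iota 0 n].

Lemma cellsS p n : cells p n.+1 = p :: cells (p + 1) n.
Proof.
rewrite /cells /= addr0; congr (_ :: _); rewrite -[in LHS]add1n iotaDl -map_comp.
by apply: eq_map => i /=; rewrite PoszD addrA.
Qed.

Lemma mem_cells p n k : (k \in cells p n) = (p <= k < p + n%:Z).
Proof.
elim: n p => [|n IHn] p; first by rewrite in_nil; apply/esym/negbTE; lia.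
by rewrite cellsS in_cons IHn; lia.
Qed.

Lemma cells_uniq p n : uniq (cells p n).
Proof. by rewrite map_inj_uniq ?iota_uniq // => i j /addrI [->]. Qed.

Definition local_rule := bool -> bool -> bool -> bool.

Definition step (h1 h0 : local_rule) (w x : int -> bool) : int -> bool :=
  fun k => (if w k then h1 else h0) (x (k - 1)) (x k) (x (k + 1)).

Definition keep : local_rule := fun _ y _ => y.

Section DeadRuns.
Variable c : bool.
Implicit Types (x w : int -> bool) (r : int * nat).

Definition dead x (k : int) : bool :=
  [&& x (k - 1) == c, x k == c & x (k + 1) == c].

Definition dead_run x r : bool := all (dead x) (cells r.1 r.2).

Definition separated x r1 r2 : bool :=
  `[< exists k, [/\ r1.1 + r1.2%:Z <= k, k < r2.1 & ~~ dead x k] >].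

Definition dead_family x (F : seq (int * nat)) : bool :=
  all (dead_run x) F && pairwise (separated x) F.

Definition block r : seq int := cells (r.1 - 1) r.2.+2.

Definition label x (k : int) : symbol :=
  if dead x k then None else Some (x k == c).

Lemma dead_runP x r :
  reflect (forall k, r.1 <= k < r.1 + r.2%:Z -> dead x k) (dead_run x r).
Proof.
apply: (iffP allP) => h k; first by rewrite -mem_cells => /h.
by rewrite mem_cells => /h.
Qed.

Lemma dead_run_block x r : dead_run x r -> (0 < r.2)%N ->
  forall k, k \in block r -> x k = c.
Proof.
move=> /dead_runP h r0 k; rewrite mem_cells => kr.
have [lo|hi] := boolP (k == r.1 - 1).
  have /h/and3P[/eqP <- _ _] : r.1 <= r.1 < r.1 + r.2%:Z by lia.
  by congr (x _); lia.
have [hi'|hi'] := boolP (k == r.1 + r.2%:Z).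
  have /h/and3P[_ _ /eqP <-] : r.1 <= k - 1 < r.1 + r.2%:Z by lia.
  by congr (x _); lia.
by have /h/and3P[_ /eqP] : r.1 <= k < r.1 + r.2%:Z by lia.
Qed.

Local Notation flip := flip_if_not_all_equal.
Local Notation step := (step flip keep).

Lemma step_dead w x k : dead x k -> step w x k = c.
Proof.
by rewrite /Defs.flip_if_not_all_equal /step; case/and3P=> /eqP -> /eqP -> /eqP ->;
   case: (w k); rewrite /keep /flip // !eqxx.
Qed.

Lemma step_fail w x k : step w x k = c -> label x k = Some true -> w k = false.
Proof.
rewrite /label /dead /step /keep /flip.
by case: (w k) (x _) (x _) (x _) c => -[] [] [] [].
Qed.

(** Cell [k] took the colour [c] by flipping, so its neighbourhood was not constant. This is what
    limits runs of [Some false] to length two. *)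
Lemma step_lone w x k : step w x k = c -> x (k - 1) != c -> x k != c ->
  x (k + 1) == c.
Proof.
rewrite /step /keep /flip.
by case: (w k) (x _) (x _) (x _) c => -[] [] [] [].
Qed.

(** The neighbours of a dead cell have colour [c], so [None] and [Some false] are never adjacent;
    [step_lone] excludes three [Some false] in a row. The last three hypotheses record what the
    letters before [p] impose. *)
Lemma admissible_labels w x j m p N :
  (forall k, k \in cells p N -> step w x k = c) ->
  ((0 < m)%N -> dead x (p - 1)) -> ((0 < j)%N -> x (p - 1) != c) ->
  ((1 < j)%N -> x p == c) ->
  admissible j m [seq label x k | k <- cells p N].
Proof.
elim: N j m p => [|N IHN] j m p //; rewrite cellsS => h m0 j0 j1.
have hp : step w x p = c by apply: h; rewrite mem_head.
have h' k : k \in cells (p + 1) N -> step w x k = c.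
  by move=> kN; apply: h; rewrite in_cons kN orbT.
have p1 : p + 1 - 1 = p by rewrite addrK.
rewrite /= {1}/label; case: ifPn => [dp|ndp].
  have j_eq0 : j = 0%N.
    by case: j j0 {j1} => // j /(_ isT); case/and3P: dp => ->.
  by rewrite j_eq0 /=; apply: IHN => //; rewrite p1.
case xp: (x p == c); first by apply: IHN; rewrite ?p1.
have m_eq0 : m = 0%N.
  by case: m m0 => // m /(_ isT) /and3P[_ _]; rewrite subrK xp.
have j2 : (j < 2)%N by rewrite ltnNge; apply/negP => /j1; rewrite xp.
rewrite m_eq0 j2 /=; apply: IHN; rewrite ?p1 ?xp // ltnS => /j0 xp1.
by apply: step_lone hp _ _; rewrite ?xp.
Qed.

Definition runs_within x (a b : int) (S : seq (int * nat)) : Prop :=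
  dead_family x S /\
  forall r, r \in S -> [/\ (0 < r.2)%N, a <= r.1 & r.1 + r.2%:Z <= b].

(** The cell that closes a run is live, and it separates this run from all later ones. The parameter
    [m] lets the induction enter the word inside a run. *)
Lemma runsP x m p N : (forall k, p - m%:Z <= k < p -> dead x k) ->
  runs_within x (p - m%:Z) (p + N%:Z) (runs m p [seq label x k | k <- cells p N]).
Proof.
have closeP q n M : (forall k, q - n%:Z <= k < q -> dead x k) ->
    dead_family x (close_run n q) /\ forall r, r \in close_run n q ->
    [/\ (0 < r.2)%N, q - n%:Z <= r.1, r.1 + r.2%:Z = q & r.1 + r.2%:Z <= q + M%:Z].
  case: n => [|n] h; first by [].
  split=> [|r]; last by rewrite inE => /eqP -> /=; split=> //; lia.
  by rewrite /dead_family /= !andbT; apply/dead_runP => k /= kq; apply: h; lia.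
elim: N m p => [|N IHN] m p h.
  by have [h1 h2] := closeP p m 0%N h; split=> // r /h2[].
rewrite cellsS /= {1}/label; case: ifPn => [dp|ndp] /=.
  have /= [|h1 h2] := IHN m.+1 (p + 1).
    move=> k kp; have [->//|nkp] := eqVneq k p; apply: h; lia.
  by split=> // r /h2 [? ? ?]; split=> //; lia.
have /= [|h1 h2] := IHN 0%N (p + 1); first by move=> k; lia.
have [h3 h4] := closeP p m N.+1 h.
split; last first.
  by move=> r; rewrite mem_cat => /orP[/h4[? ? _ ?]|/h2[? ? ?]]; split=> //; lia.
rewrite /dead_family all_cat pairwise_cat.
move: h1 h3 => /andP[-> ->] /andP[-> ->]; rewrite !andbT /=.
apply/allrelP => r1 r2 /h4[_ _ e _] /h2[_ lo _]; apply/asboolP.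
by exists p; split=> //; lia.
Qed.

(** A live cell has, at distance at most one, a cell [u] of the colour other than [c]. Both blocks
    are entirely of colour [c], so [u] lies strictly between them. *)
Lemma separated_block x r1 r2 j k : separated x r1 r2 ->
  dead_run x r1 -> dead_run x r2 -> (0 < r1.2)%N -> (0 < r2.2)%N ->
  j \in block r1 -> k \in block r2 -> j < k.
Proof.
move=> /asboolP[z [z1 z2 nz]] d1 d2 n1 n2.
have h1 := dead_run_block d1 n1; have h2 := dead_run_block d2 n2.
have [u uz [u1 u2]] : exists2 u, z - 1 <= u <= z + 1 &
    u \notin block r1 /\ u \notin block r2.
  move: nz; rewrite /dead !negb_and => /or3P[] xu; [exists (z - 1)|exists z|exists (z + 1)];
    rewrite ?lexx ?andbT; try lia;
    by split; [apply: contra xu => /h1 -> | apply: contra xu => /h2 ->].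
move: u1 u2; rewrite !mem_cells; lia.
Qed.

(* An activity gap between two dead runs was already there one step before:
   a stretch of dead cells stays dead. *)
Lemma separated_step w x r1 r2 s1 s2 : separated (step w x) r1 r2 ->
  dead_run (step w x) r1 -> dead_run (step w x) r2 ->
  (0 < r1.2)%N -> (0 < r2.2)%N -> dead_run x s1 -> dead_run x s2 ->
  (0 < s1.2)%N -> (0 < s2.2)%N ->
  r1.1 - 1 <= s1.1 -> s1.1 + s1.2%:Z <= r1.1 + r1.2%:Z + 1 ->
  r2.1 - 1 <= s2.1 -> s2.1 + s2.2%:Z <= r2.1 + r2.2%:Z + 1 ->
  separated x s1 s2.
Proof.
move=> /asboolP[k [k1 k2 nk]] d1 d2 n1 n2 e1 e2 m1 m2 a1 b1 a2 b2.
apply: contrapT => /negP/asboolPn nsep.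
have dx j : s1.1 <= j < s2.1 + s2.2%:Z -> dead x j.
  move=> js; apply/negPn/negP => ndj.
  have [j1|j1] := ltP j (s1.1 + s1.2%:Z).
    by move/dead_runP: e1 ndj => /(_ j) ->//; lia.
  have [j2|j2] := ltP j s2.1; first by apply: nsep; exists j.
  by move/dead_runP: e2 ndj => /(_ j) ->//; lia.
have x'c j : k - 1 <= j <= k + 1 -> step w x j = c.
  move=> jk; have [jb1|nj1] := boolP (j \in block r1); first exact: dead_run_block jb1.
  have [jb2|nj2] := boolP (j \in block r2); first exact: dead_run_block jb2.
  by apply: step_dead; apply: dx; move: nj1 nj2; rewrite !mem_cells; lia.
by move: nk; rewrite /dead !x'c ?eqxx //; lia.
Qed.

Definition words_of x (F : seq (int * nat)) : seq (seq symbol) :=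
  [seq [seq label x k | k <- block r] | r <- F].

Definition runs_of (F : seq (int * nat)) (ws : seq (seq symbol)) :=
  flatten [seq runs 0 (rv.1.1 - 1) rv.2 | rv <- zip F ws].

Lemma runs_of_cons r F v ws :
  runs_of (r :: F) (v :: ws) = runs 0 (r.1 - 1) v ++ runs_of F ws.
Proof. by []. Qed.

Lemma runs_of_words x F (s : int * nat) : s \in runs_of F (words_of x F) ->
  exists2 r : int * nat, r \in F & [/\ dead_run x s, (0 < s.2)%N, r.1 - 1 <= s.1 &
                           s.1 + s.2%:Z <= r.1 + r.2%:Z + 1].
Proof.
elim: F => [|r F IHF] //; rewrite runs_of_cons mem_cat => /orP[sr|/IHF[r' r'F h]].
  have [|/andP[/allP hd _] /(_ _ sr) [s0 lo hi]] := @runsP x 0 (r.1 - 1) r.2.+2.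
    by move=> k; lia.
  exists r; first exact: mem_head.
  by split=> //; [exact: hd | lia | lia].
by exists r' => //; rewrite in_cons r'F orbT.
Qed.

(** Runs found in one block are separated by [runsP], runs found in different blocks by
    [separated_step]. Families of dead runs can thus be followed back to time 0. *)
Lemma dead_family_step w x F : all (fun r => (0 < r.2)%N) F ->
  dead_family (step w x) F -> dead_family x (runs_of F (words_of x F)).
Proof.
elim: F => [|r F IHF] //= /andP[r0 F0] /andP[/= /andP[dr dF] /andP[sr sF]].
have hF : dead_family (step w x) F by apply/andP.
have [|/andP[h1 h2] h] := @runsP x 0 (r.1 - 1) r.2.+2; first by move=> k; lia.
have /andP[h3 h4] := IHF F0 hF.
rewrite runs_of_cons /dead_family all_cat pairwise_cat h1 h2 h3 h4 !andbT /=.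
apply/allrelP => s1 s2 s1r /runs_of_words[r' r'F [e2 m2 a2 b2]].
have [m1 a1 b1] := h _ s1r.
apply: (@separated_step w x r r') => //.
- exact: (allP sr).
- exact: (allP dF).
- exact: (allP F0).
- exact: (allP h1).
- by move: a1; clear; lia.
- by move: b1; clear; lia.
Qed.

(** Serves to make the coins read in the various blocks distinct, hence independent. *)
Lemma uniq_blocks x F : all (fun r => (0 < r.2)%N) F -> dead_family x F ->
  uniq (flatten [seq block r | r <- F]).
Proof.
elim: F => [|r F IHF] // /andP[r0 F0] /andP[/andP[dr dF] /andP[sr sF]].
rewrite -[flatten _]/(block r ++ flatten [seq block s | s <- F]) cat_uniq cells_uniq.
rewrite IHF //; last exact/andP.
rewrite andbT.
apply/hasPn => k /flattenP[_ /mapP[r' r'F ->] kr']; apply/negP => kr.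
by have := separated_block (allP sr _ r'F) dr (allP dF _ r'F) r0 (allP F0 _ r'F) kr kr';
   rewrite ltxx.
Qed.

End DeadRuns.
(** * Finite windows of coins *)

Section Coins.
Variables (R : realType) (alpha : R).
Hypothesis alpha01 : 0 <= alpha <= 1.
Implicit Types (phi psi : (int -> bool) -> R) (W l : seq int).

Definition update (w : int -> bool) (k : int) (b : bool) : int -> bool :=
  fun j => if j == k then b else w j.

(* The coins of the cells in [W] are independent; all other coins are [true],
   so that the state of the window [W] is a function of finitely many coins. *)
Fixpoint coin_mean W phi : R :=
  if W is k :: W'
  then alpha * coin_mean W' (fun w => phi (update w k true)) +
       (1 - alpha) * coin_mean W' (fun w => phi (update w k false))
  else phi (fun=> true).

Lemma coin_mean_linear W a phi psi :
  coin_mean W (fun w => a * phi w + psi w) = a * coin_mean W phi + coin_mean W psi.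
Proof. by elim: W phi psi => [|k W IHW] phi psi //=; rewrite !IHW; ring. Qed.

Lemma coin_mean_ge0 W phi : (forall w, 0 <= phi w) -> 0 <= coin_mean W phi.
Proof.
move: alpha01 => /andP[a0 a1].
elim: W phi => [|k W IHW] phi phi0 //=.
by rewrite addr_ge0 ?mulr_ge0 ?subr_ge0 ?IHW.
Qed.

Lemma coin_mean_cst W a : coin_mean W (fun=> a) = a.
Proof. by elim: W => //= k W ->; ring. Qed.

Lemma coin_mean_prod W l (g : int -> bool -> R) : uniq l ->
  coin_mean W (fun w => \prod_(k <- l) g k (w k)) =
  \prod_(k <- l) (if k \in W then alpha * g k true + (1 - alpha) * g k false
                  else g k true).
Proof.
move=> ul; elim: W g => [|i W IHW] g //=.
have E b : coin_mean W (fun w => \prod_(k <- l) g k (update w i b k)) =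
    \prod_(k <- l) (if k == i then g i b else
      if k \in W then alpha * g k true + (1 - alpha) * g k false else g k true).
  (* Setting the coin of [i] freezes the factor at [i]; averaging a frozen factor leaves it
     unchanged, even if [i] occurs again in [W]. *)
  pose g' k c := if k == i then g i b else g k c.
  have -> : (fun w => \prod_(k <- l) g k (update w i b k)) =
      (fun w => \prod_(k <- l) g' k (w k)).
    apply/funext => w; apply: eq_bigr => k _; rewrite /update /g'.
    by case: eqP => [->|].
  rewrite IHW /g'; apply: eq_bigr => k _; case: eqP => // _.
  by case: ifP => // _; ring.
rewrite !E; under [RHS]eq_bigr do rewrite in_cons.
have [il|nil] := boolP (i \in l); last first.
  set P := RHS; have -> : P = alpha * P + (1 - alpha) * P by ring.
  congr (_ * _ + _ * _); apply: eq_big_seq => k kl;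
    by case: eqP => // ki; rewrite -ki kl in nil.
rewrite !(bigD1_seq i) //= eqxx /=.
under [X in _ * (_ * X) + _]eq_bigr => k /negbTE ->; first over.
under [X in _ + _ * (_ * X)]eq_bigr => k /negbTE ->; first over.
under [X in _ = _ * X]eq_bigr => k /negbTE ->; first over.
rewrite /=; ring.
Qed.

(** Independence, with an inequality only because the coin of a cell outside [W] is always [true]
    and never fails. *)
Lemma coin_mean_fail W l : uniq l ->
  coin_mean W (fun w => (all (fun k => ~~ w k) l)%:R) <= (1 - alpha) ^+ size l.
Proof.
move=> ul; have /andP[a0 a1] := alpha01.
pose g (k : int) b : R := (~~ b)%:R.
have -> : (fun w : int -> bool => (all (fun k => ~~ w k) l)%:R : R) =
    fun w => \prod_(k <- l) g k (w k).
  apply/funext => w; elim: l {ul} => [|k l IHl]; first by rewrite big_nil.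
  by rewrite big_cons /= -IHl; case: (w k); rewrite ?mul0r ?mul1r.
rewrite coin_mean_prod // /g; elim: l {ul} => [|k l IHl]; first by rewrite big_nil.
rewrite big_cons /= exprS; apply: ler_pM => //; first last.
- by case: ifP; lra.
- by apply: prodr_ge0 => j _; case: ifP; lra.
- by case: ifP; lra.
Qed.

End Coins.

(** * Normalised positive functionals and the dynamics on a window *)

Section Means.
Variable R : realType.
Implicit Types (M : ((int -> bool) -> R) -> R) (phi psi : (int -> bool) -> R).

(** Expectation under a finitely additive probability, applicable to every function of the
    configuration. *)
Record is_mean M : Prop := IsMean {
  mean_linear : forall a phi psi, M (fun x => a * phi x + psi x) = a * M phi + M psi;
  mean_ge0 : forall phi, (forall x, 0 <= phi x) -> 0 <= M phi;
  mean1 : M (fun=> 1) = 1 }.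

Section Theory.
Variable M : ((int -> bool) -> R) -> R.
Hypothesis hM : is_mean M.

Lemma mean0 : M (fun=> 0) = 0.
Proof.
have -> : (fun=> 0) = (fun _ : int -> bool => -1 * 1 + 1 : R).
  by apply/funext => x; rewrite mulN1r addNr.
by rewrite mean_linear // mulN1r addNr.
Qed.

Lemma mean_le phi psi : (forall x, phi x <= psi x) -> M phi <= M psi.
Proof.
move=> h; rewrite -subr_ge0.
have <- : M (fun x => (-1) * phi x + psi x) = M psi - M phi.
  by rewrite mean_linear // mulN1r addrC.
by apply: mean_ge0 => // x; rewrite mulN1r addrC subr_ge0.
Qed.

Lemma mean_sum (I : Type) (s : seq I) (a : I -> R) (phi : I -> (int -> bool) -> R) :
  M (fun x => \sum_(i <- s) a i * phi i x) = \sum_(i <- s) a i * M (phi i).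
Proof.
elim: s => [|i s IHs].
  by rewrite big_nil -[RHS]mean0; congr M; apply/funext => x; rewrite big_nil.
rewrite big_cons -IHs -mean_linear //.
by congr M; apply/funext => x; rewrite big_cons.
Qed.

End Theory.
End Means.
Section Evolution.
Variables (R : realType) (alpha : R) (h1 h0 : local_rule).
Hypothesis alpha01 : 0 <= alpha <= 1.
Implicit Types (phi psi : (int -> bool) -> R) (W : seq int).

Lemma is_mean_coin W : is_mean (coin_mean alpha W).
Proof.
split=> [||]; [exact: coin_mean_linear | exact: coin_mean_ge0 | exact: coin_mean_cst].
Qed.

Definition evolve W phi : (int -> bool) -> R :=
  fun x => coin_mean alpha W (fun w => phi (step h1 h0 w x)).

(** The Markov semigroup acting on observables: the expectation of [phi] at time [t] for the process
    started at [x0]. *)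
Definition state W (x0 : int -> bool) (t : nat) phi : R := iter t (evolve W) phi x0.

Lemma stateS W x0 t phi : state W x0 t.+1 phi = state W x0 t (evolve W phi).
Proof. by rewrite /state iterSr. Qed.

Lemma is_mean_state W x0 t : is_mean (state W x0 t).
Proof.
elim: t => [|t [l p u]]; first by split=> // phi h; apply: h.
split=> [a phi psi|phi phi0|]; rewrite !stateS.
- by rewrite -l; congr state; apply/funext => x; rewrite /evolve coin_mean_linear.
- by apply: p => x; apply: coin_mean_ge0.
- by rewrite -[RHS]u; congr state; apply/funext => x; rewrite /evolve coin_mean_cst.
Qed.

End Evolution.

(** * Union bound over the label words of a family of runs *)

Lemma mem_words v : v \in words (size v).
Proof.
elim: v => [|s v IHv] //; apply: (allpairs_f cons) => //.
by case: s => [[]|]; rewrite !inE.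
Qed.

Fixpoint word_choices (F : seq (int * nat)) : seq (seq (seq symbol)) :=
  if F is r :: F' then [seq v :: ws | v <- words r.2.+2, ws <- word_choices F']
  else [:: [::]].

Lemma words_of_choices c x F : words_of c x F \in word_choices F.
Proof.
elim: F => [|r F IHF] //; apply: (allpairs_f cons) => //.
by have := mem_words [seq label c x k | k <- block r]; rewrite !size_map size_iota.
Qed.

Lemma runs_gt0 m p v : all (fun r => (0 < r.2)%N) (runs m p v).
Proof.
have h q n : all (fun r => (0 < r.2)%N) (close_run n q) by case: n.
by elim: v m p => [|[b|] v IHv] m p //=; rewrite all_cat h IHv.
Qed.

Section Contours.
Variables (R : realType) (eps : R).
Hypothesis eps_ge0 : 0 <= eps.

Definition choice_weight (ws : seq (seq symbol)) : R :=
  \prod_(v <- ws) ((admissible 0 0 v)%:R * eps ^+ nfail v).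

Lemma choice_weight_ge0 ws : 0 <= choice_weight ws.
Proof. by apply: prodr_ge0 => v _; rewrite mulr_ge0 ?exprn_ge0. Qed.

(** Both factors split over the blocks, so the sum over tuples of words becomes a product of sums,
    one [total] per block. *)
Lemma sum_word_choices (f : nat -> R) F : (forall n, 0 <= f n) ->
  \sum_(ws <- word_choices F) choice_weight ws * \prod_(r <- runs_of F ws) f r.2
  <= \prod_(r <- F) total eps f 0 0 r.2.+2.
Proof.
move=> f0; elim: F => [|r F IHF].
  by rewrite big_seq1 /choice_weight !big_nil mulr1.
rewrite big_allpairs_dep big_cons /total mulr_suml ler_sum // => v _.
have -> : \sum_(ws <- word_choices F)
    choice_weight (v :: ws) * \prod_(s <- runs_of (r :: F) (v :: ws)) f s.2 =
  ((admissible 0 0 v)%:R * eps ^+ nfail v * \prod_(s <- runs 0 (r.1 - 1) v) f s.2) *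
  \sum_(ws <- word_choices F) choice_weight ws * \prod_(s <- runs_of F ws) f s.2.
  rewrite mulr_sumr; apply: eq_bigr => ws _.
  by rewrite runs_of_cons big_cat /choice_weight big_cons /=; ring.
apply: ler_pM IHF.
- by rewrite !mulr_ge0 ?exprn_ge0 ?prodr_ge0.
- by apply: sumr_ge0 => ws _; rewrite mulr_ge0 ?choice_weight_ge0 ?prodr_ge0.
- have [adm|_] := boolP (admissible 0 0 v); last by rewrite !mul0r word_weight_ge0.
  by rewrite mul1r (word_weight_admissible _ _ (r.1 - 1) adm).
Qed.

End Contours.

Section DeadFamilyBound.
Variables (R : realType) (alpha : R) (c : bool).
Hypothesis alpha01 : 0 <= alpha <= 1.
Let eps : R := 1 - alpha.
Implicit Types F : seq (int * nat).

Local Notation flip := flip_if_not_all_equal.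

(** For a given [x] the labels are determined, and the single term [words_of c x F] suffices: the
    family is dead after the step only if every coin at a cell labelled [Some true] fails, and these
    cells are distinct. Summing over all words makes the weights independent of [x]. *)
Lemma evolve_dead_family W F x : all (fun r => (0 < r.2)%N) F ->
  evolve alpha flip keep W (fun y => (dead_family c y F)%:R) x <=
  \sum_(ws <- word_choices F)
    choice_weight eps ws * (dead_family c x (runs_of F ws))%:R.
Proof.
move=> F0; have e0 : 0 <= eps by rewrite /eps; move: alpha01; lra.
(* If no coins make the family dead, the mean vanishes. Otherwise one witness [w0] is enough for
   admissibility and for the earlier runs, since both depend on [x] alone. *)
have [[w0 hw0]|none] := pselect (exists w, dead_family c (step flip keep w x) F);
    last first.
  rewrite /evolve; set phi := (X in coin_mean _ _ X); have -> : phi = fun=> 0.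
    by apply/funext => w; rewrite /phi; case: (boolP (dead_family _ _ _)) => // h;
      case: none; exists w.
  rewrite (mean0 (is_mean_coin alpha01 W)) sumr_ge0 // => ws _.
  by rewrite mulr_ge0 ?choice_weight_ge0.
set ws := words_of c x F; set S := word_choices F.
have S0 v : 0 <= choice_weight eps v * (dead_family c x (runs_of F v))%:R.
  by rewrite mulr_ge0 ?choice_weight_ge0.
apply: (@le_trans _ _ (choice_weight eps ws)); last first.
  have : ws \in S by apply: words_of_choices.
  elim: S => // v S IHS; rewrite in_cons big_cons => /orP[/eqP <-|/IHS h].
    rewrite (dead_family_step F0 hw0) mulr1 lerDl; exact: sumr_ge0.
  by apply: le_trans h _; rewrite lerDr.
have c_x' : forall k, k \in flatten [seq block r | r <- F] ->
    forall w, dead_family c (step flip keep w x) F -> step flip keep w x k = c.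
  move=> k /flattenP[_ /mapP[r rF ->] kr] w /andP[/allP hd _].
  by apply: dead_run_block kr; [exact: hd | exact: (allP F0)].
pose fails := [seq k <- flatten [seq block r | r <- F] | label c x k == Some true].
have -> : choice_weight eps ws = eps ^+ size fails.
  have {}c_x' k kF := c_x' k kF w0 hw0.
  rewrite /fails /ws {F0 S S0 ws fails hw0}; elim: F c_x' => [|r F IHF] c_x'.
    by rewrite /choice_weight big_nil.
  have mem_r k : k \in block r -> k \in flatten [seq block r | r <- r :: F].
    by rewrite mem_cat => ->.
  have mem_F k : k \in flatten [seq block r | r <- F] ->
      k \in flatten [seq block r | r <- r :: F].
    by rewrite mem_cat => ->; rewrite orbT.
  have adm : admissible 0 0 [seq label c x k | k <- block r].
    by apply: (@admissible_labels c w0) => // k /mem_r/c_x'.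
  have {}IHF := IHF (fun k kF => c_x' k (mem_F k kF)).
  have -> : words_of c x (r :: F) = [seq label c x k | k <- block r] :: words_of c x F.
    by [].
  rewrite /choice_weight big_cons adm mul1r.
  rewrite -[X in _ * X]/(choice_weight eps (words_of c x F)) IHF.
  have -> : flatten [seq block r | r <- r :: F] =
      block r ++ flatten [seq block r | r <- F].
    by [].
  rewrite filter_cat size_cat exprD; congr (eps ^+ _ * _).
  by rewrite /nfail count_map size_filter.
have ufails : uniq fails by apply: filter_uniq; apply: uniq_blocks F0 hw0.
apply: le_trans (coin_mean_fail alpha01 W ufails).
apply: (mean_le (is_mean_coin alpha01 W)) => w.
case: (boolP (dead_family _ _ _)) => hw; last by rewrite ler0n.
rewrite (_ : all _ _) //; apply/allP => k; rewrite mem_filter => /andP[/eqP lk kF].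
by rewrite (step_fail (c_x' k kF w hw) lk).
Qed.

(** Induction on the time. At time 0 no cell is dead, so a nonempty family has probability 0, as
    does its bound, while the empty family gives the empty product. *)
Lemma state_dead_family W x0 t F :
  (forall k, ~~ dead c x0 k) -> all (fun r => (0 < r.2)%N) F ->
  state alpha flip keep W x0 t (fun y => (dead_family c y F)%:R) <=
  \prod_(r <- F) run_bound eps t r.2.
Proof.
move=> x0_alive; have e0 : 0 <= eps by rewrite /eps; move: alpha01; lra.
elim: t F => [|t IHt] F F0.
  case: F F0 => [_|r F /andP[r0 _]]; first by rewrite big_nil.
  rewrite big_cons mul0r /state /= (_ : dead_family c x0 _ = false) //.
  apply/negbTE; apply/negP => /andP[/andP[/dead_runP/(_ r.1) h _] _].
  by have := x0_alive r.1; rewrite h //; lia.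
have hM := is_mean_state flip keep alpha01 W x0 t.
rewrite stateS; apply: le_trans (mean_le hM (fun x => evolve_dead_family W x F0)) _.
rewrite (mean_sum hM); apply: le_trans _ (sum_word_choices e0 F (run_bound_ge0 e0 t)).
rewrite big_seq [leRHS]big_seq ler_sum // => ws wsF.
apply: ler_wpM2l; first exact: choice_weight_ge0.
apply: IHt; elim: F ws wsF {F0} => [|r F IHF] ws; first by rewrite inE => /eqP ->.
case/allpairsP => -[v ws'] /= [vr ws'F ->]; rewrite runs_of_cons all_cat IHF // andbT.
exact: runs_gt0.
Qed.

End DeadFamilyBound.
(** * Measures from finitely additive cylinder masses *)

Section UnitInterval.
Local Open Scope classical_set_scope.
Variable R : realType.

Definition unit_lebesgue : set (measurableTypeR R) -> \bar R :=
  mrestr lebesgue_measure (measurable_itv (Interval (BLeft 0%R) (BLeft 1%R))).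

HB.instance Definition _ := Measure.on unit_lebesgue.

Lemma unit_lebesgue_setT : unit_lebesgue [set: measurableTypeR R] = 1%E.
Proof.
by rewrite /unit_lebesgue /mrestr setTI lebesgue_measure_itv /= lte_fin ltr01 sube0.
Qed.

HB.instance Definition _ :=
  Measure_isProbability.Build _ _ _ unit_lebesgue unit_lebesgue_setT.

End UnitInterval.

Section Extension.
Local Open Scope classical_set_scope.
Variables (R : realType) (I : countType) (m : set (I -> bool) -> R).
Hypotheses (m_ge0 : forall A, 0 <= m A) (m_setT : m setT = 1)
  (m_additive : forall A B, A `&` B = set0 -> m (A `|` B) = m A + m B).

Let coordinate (n : nat) (x : I -> bool) : bool :=
  if choice.unpickle n is Some i then x i else false.

(* Words are written with the last digit first. *)
Let prefix (x : I -> bool) : nat -> seq bool :=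
  fix prefix n := if n is n'.+1 then coordinate n' x :: prefix n' else [::].

Let mass (w : seq bool) : R := m [set x | prefix x (size w) = w].

(* The words of length [n] label consecutive intervals of [[0, 1[] of lengths
   given by [mass]; [lower w] is the left end of the interval of [w], and
   [digits u n] is the word whose interval contains [u]. *)
Let lower : seq bool -> R :=
  fix lower w :=
    if w is b :: w' then lower w' + (if b then mass (false :: w') else 0) else 0.

Let digits (u : R) : nat -> seq bool :=
  fix digits n :=
    if n is n'.+1
    then (lower (digits n') + mass (false :: digits n') <= u) :: digits n'
    else [::].

Lemma mass_split w : mass w = mass (false :: w) + mass (true :: w).
Proof.
rewrite /mass -m_additive /=; last first.
  by apply/seteqP; split=> x //= -[[-> _]].
congr m; apply/seteqP; split=> x /=; last by case=> -[].
by move=> xw; case: (coordinate _ _); [right|left]; rewrite xw.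
Qed.

Lemma digits_interval w :
  [set u | digits u (size w) = w] `&` `[0, 1[ = `[lower w, lower w + mass w[.
Proof.
elim: w => [|b w IHw].
  rewrite /mass /= (_ : [set x : I -> bool | _] = setT); last exact/seteqP.
  rewrite m_setT add0r (_ : [set u : R | _] = setT) ?setTI //; exact/seteqP.
have -> : [set u | digits u (size (b :: w)) = b :: w] `&` `[0, 1[ =
    [set u | (lower w + mass (false :: w) <= u) = b] `&`
    ([set u | digits u (size w) = w] `&` `[0, 1[).
  apply/seteqP; split=> u /=.
    by move=> [[e dw] u01]; rewrite dw in e.
  by move=> [e [dw u01]]; rewrite dw e.
rewrite IHw; have := mass_split w.
have := m_ge0 [set x | prefix x (size w).+1 = false :: w].
have := m_ge0 [set x | prefix x (size w).+1 = true :: w].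
rewrite -/(mass (true :: w)) -/(mass (false :: w)) => p1 p0 e.
apply/seteqP; split=> u /=; rewrite !in_itv /=.
  by case=> [h /andP[h1 h2]]; case: b h => /= h; lra.
case: b => /= /andP[h1 h2]; split; lra.
Qed.

Lemma measurable_digits w :
  measurable [set u : measurableTypeR R | digits u (size w) = w].
Proof.
elim: w => [|b w IHw]; first by rewrite (_ : [set u | _] = setT) //; exact/seteqP.
have -> : [set u : measurableTypeR R | digits u (size (b :: w)) = b :: w] =
    (if b then `[lower w + mass (false :: w), +oo[ else `]-oo, lower w + mass (false :: w)[)
    `&` [set u | digits u (size w) = w].
  apply/seteqP; split=> u /=.
    move=> [e dw]; rewrite dw in e *; split=> //.
    by case: b e => /= e; rewrite in_itv /= ?e // ltNge e.
  move=> [e dw]; rewrite dw; congr (_ :: _).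
  by case: b e => /=; rewrite in_itv /= ?andbT // leNgt => ->.
by apply: measurableI => //; case: b; exact: measurable_itv.
Qed.

(** Splitting on the next digit lowers [j], both sides being additive. At [j = 0] the set is either
    empty or the interval of [w], whose length is [mass w]. *)
Lemma digits_law (Q : seq bool -> Prop) w j :
  let A := [set u : measurableTypeR R |
    digits u (size w) = w /\ Q (digits u (size w + j))] in
  measurable A /\
  unit_lebesgue A = (m [set x | prefix x (size w) = w /\ Q (prefix x (size w + j))])%:E.
Proof.
elim: j w => [|j IHj] w A; rewrite {}/A.
  rewrite addn0; have [Qw|nQw] := pselect (Q w); last first.
    rewrite [X in m X](_ : _ = set0); last by apply/seteqP; split=> u //= [-> ].
    have -> : [set u : measurableTypeR R | digits u (size w) = w /\
        Q (digits u (size w))] = set0 by apply/seteqP; split=> u //= [-> ].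
    split=> //; rewrite measure0; have := @m_additive set0 set0 (setI0 _).
    by rewrite setU0 => h; congr (_%:E); lra.
  rewrite [X in m X](_ : _ = [set x | prefix x (size w) = w]); last first.
    by apply/seteqP; split=> u /= => [[]|h] //; rewrite h.
  have -> : [set u : measurableTypeR R | digits u (size w) = w /\
      Q (digits u (size w))] = [set u | digits u (size w) = w].
    by apply/seteqP; split=> u /= => [[]|h] //; rewrite h.
  split; first exact: measurable_digits.
  rewrite /unit_lebesgue /mrestr digits_interval lebesgue_measure_itv /= lte_fin.
  have w0 : 0 <= mass w by apply: m_ge0.
  rewrite -/(mass w); case: ltP => h; first by rewrite -EFinB addrAC subrr add0r.
  by congr (_%:E); lra.
have [m1 e1] := IHj (true :: w); have [m0 e0] := IHj (false :: w).
move: m1 e1 m0 e0; rewrite addnS [size (true :: w)]/= [size (false :: w)]/= !addSn.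
set A1 := [set u : measurableTypeR R | _]; set B1 := [set x : I -> bool | _].
set A0 := [set u : measurableTypeR R | digits u _ = false :: _ /\ _].
set B0 := [set x : I -> bool | prefix x _ = false :: _ /\ _].
move=> m1 e1 m0 e0.
have -> : [set u : measurableTypeR R | digits u (size w) = w /\
    Q (digits u (size w + j).+1)] = A0 `|` A1.
  apply/seteqP; split=> u; last by move=> [] [/= [_ dw] Qu].
  move=> [dw Qu]; rewrite /A0 /A1 /= dw.
  by case: (_ <= u); [right|left].
rewrite [X in m X](_ : _ = B0 `|` B1); last first.
  apply/seteqP; split=> x; last by move=> [] [/= [_ dw] Qu].
  move=> [dw Qu]; rewrite /B0 /B1 /= dw.
  by case: (coordinate _ _); [right|left].
split; first exact: measurableU.
rewrite measureU //; last first.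
  by apply/seteqP; split=> u // -[[h _] [h' _]]; have := etrans (esym h) h'.
rewrite m_additive ?EFinD -?e0 -?e1 //.
by apply/seteqP; split=> u // -[[h _] [h' _]]; have := etrans (esym h) h'.
Qed.

Lemma nth_digits u n j : (j < n)%N ->
  nth false (digits u n) (n - j.+1) = head false (digits u j.+1).
Proof.
elim: n => // n IHn; rewrite ltnS leq_eqVlt => /orP[/eqP ->|jn].
  by rewrite subnn.
by rewrite subSn // [LHS]/= IHn.
Qed.

Lemma nth_prefix x n j : (j < n)%N ->
  nth false (prefix x n) (n - j.+1) = coordinate j x.
Proof.
elim: n => // n IHn; rewrite ltnS leq_eqVlt => /orP[/eqP ->|jn].
  by rewrite subnn.
by rewrite subSn // [LHS]/= IHn.
Qed.

Let point (u : measurableTypeR R) : config I :=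
  fun i => head false (digits u (choice.pickle i).+1).

Lemma point_law (K : {fset I}) (y : I -> bool) :
  measurable (point @^-1` cylinder K y) /\
  unit_lebesgue (point @^-1` cylinder K y) = (m (cylinder K y))%:E.
Proof.
(* Since [K] is finite, the cylinder depends on the first [n] digits only, and [digits_law] applies
   from the empty word. *)
have [n ltn] : exists n, forall k, k \in K -> (choice.pickle k < n)%N.
  by exists (\max_(k <- K) choice.pickle k).+1 => k kK; rewrite ltnS leq_bigmax_seq.
pose Q w := forall k, k \in K -> nth false w (n - (choice.pickle k).+1) = y k.
have := digits_law Q [::] n.
have -> : [set u : measurableTypeR R | digits u (size (@nil bool)) = [::] /\
    Q (digits u (size (@nil bool) + n))] = point @^-1` cylinder K y.
  apply/seteqP; split=> u /=.
    by move=> [_ h] k kK; rewrite -h // nth_digits // ltn.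
  by move=> h; split=> // k kK; rewrite -h // nth_digits // ltn.
rewrite [X in m X](_ : _ = cylinder K y) //.
apply/seteqP; split=> x /=.
  by move=> [_ h] k kK; rewrite -h // nth_prefix ?ltn // /coordinate choice.pickleK.
move=> h; split=> // k kK.
by rewrite -h // nth_prefix ?ltn // /coordinate choice.pickleK.
Qed.

Lemma measurable_point : measurable_fun setT point.
Proof.
apply: (@measurability _ _ (measurableTypeR R) (config I) setT point
  (@cylinders I)) => // _ [_ [K [y ->]] <-].
by rewrite setTI; have [] := point_law K y.
Qed.

HB.instance Definition _ := isMeasurableFun.Build _ _ _ _ point measurable_point.

(** The measure is the image of Lebesgue measure on the unit interval by the digit map. Countable
    additivity is inherited from Lebesgue measure, so finite additivity of [m] is all that has to be
    supplied. *)
Theorem cylinder_extension : exists pi : probability (config I) R,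
  forall K y, pi (cylinder K y) = (m (cylinder K y))%:E.
Proof.
exists (distribution (@unit_lebesgue R) point) => K y.
by have [] := point_law K y.
Qed.

End Extension.
(** * Invariant measures as limits of Cesaro averages *)

Section GeneralizedLimit.
Local Open Scope classical_set_scope.
Variable R : realType.
Implicit Types u v : nat -> R.

Definition bounded_seq u : Prop := exists B, forall n, `|u n| <= B.

Record is_limit_functional (L : (nat -> R) -> R) : Prop := IsLimitFunctional {
  limit_linear : forall a u v, bounded_seq u -> bounded_seq v ->
    L (fun n => a * u n + v n) = a * L u + L v;
  limit_le : forall u v, bounded_seq u -> bounded_seq v ->
    (\forall n \near \oo, u n <= v n) -> L u <= L v;
  limit_cst : forall a, L (fun=> a) = a }.

Lemma bounded_seq_linear a u v : bounded_seq u -> bounded_seq v ->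
  bounded_seq (fun n => a * u n + v n).
Proof.
move=> [B hB] [B' hB']; exists (`|a| * B + B') => n.
by apply: le_trans (ler_normD _ _) _; rewrite normrM lerD // ler_wpM2l.
Qed.

(** Limits are taken along an ultrafilter containing the cofinite sets. A bounded sequence clusters
    by compactness of a segment, and a cluster point of an ultrafilter is a limit. *)
Lemma limit_functional_exists : exists L, is_limit_functional L.
Proof.
have [U [UU sU]] := ultraFilterLemma (@eventually_filter).
have cv u : bounded_seq u -> cvg (u n @[n --> U]).
  move=> [B hB]; apply/cvg_ex.
  have [|p [_ cp]] := @segment_compact R (- B) B (u n @[n --> U]) _.
    have h : U [set n | `[- B, B] (u n)].
      by apply: filterS filterT => n _; rewrite /= in_itv /= -ler_norml; exact: hB.
    exact: h.
  exists p => V Vp; have [//|nV] := in_ultra_setVsetC (u @^-1` V) UU.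
  have nV' : (u n @[n --> U]) (~` V) by [].
  by have [z []] := cp _ _ nV' Vp.
exists (fun u => lim (u n @[n --> U])); split.
- move=> a u v /cv cu /cv cv'; apply/cvg_lim => //.
  by apply: cvgD => //; apply: cvgMr.
- move=> u v /cv cu /cv cv' uv; apply: ler_lim => //.
  exact: sU.
- by move=> a; apply/cvg_lim => //; apply: cvg_cst.
Qed.

Section LimitTheory.
Variable L : (nat -> R) -> R.
Hypothesis hL : is_limit_functional L.

Lemma limit_sum (I : Type) (s : seq I) (a : I -> R) (u : I -> nat -> R) :
  (forall i, bounded_seq (u i)) ->
  bounded_seq (fun n => \sum_(i <- s) a i * u i n) /\
  L (fun n => \sum_(i <- s) a i * u i n) = \sum_(i <- s) a i * L (u i).
Proof.
move=> bu; elim: s => [|i s [bs IHs]].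
  rewrite big_nil -[RHS](limit_cst hL); split; last first.
    by congr L; apply/funext => n; rewrite big_nil.
  by exists 0 => n; rewrite big_nil normr0.
have E : (fun n => \sum_(j <- i :: s) a j * u j n) =
    fun n => a i * u i n + \sum_(j <- s) a j * u j n.
  by apply/funext => n; rewrite big_cons.
rewrite E; split; first exact: bounded_seq_linear.
by rewrite limit_linear // big_cons IHs.
Qed.

Lemma limit_squeeze u v : bounded_seq u -> bounded_seq v ->
  (\forall n \near \oo, `|u n - v n| <= n.+1%:R^-1) -> L u = L v.
Proof.
have half u' v' : bounded_seq u' -> bounded_seq v' ->
    (\forall n \near \oo, `|u' n - v' n| <= n.+1%:R^-1) -> L u' <= L v'.
  move=> bu bv uv; apply/ler_addgt0Pl => e e0.
  have bc : bounded_seq (fun=> e : R) by exists `|e|.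
  have -> : e + L v' = L (fun n => 1 * v' n + e).
    by rewrite limit_linear // limit_cst // mul1r addrC.
  apply: limit_le => //; first exact: bounded_seq_linear.
  near=> n; have h : `|u' n - v' n| <= n.+1%:R^-1 by near: n.
  have : n.+1%:R^-1 < e by near: n; exact: (near_infty_natSinv_lt (PosNum e0)).
  rewrite mul1r -lerBlDl => /ltW; apply: le_trans; apply: le_trans h.
  exact: ler_norm.
move=> bu bv uv; apply/eqP; rewrite eq_le !half //.
by apply: filterS uv => n; rewrite distrC.
Unshelve. all: by end_near. Qed.

End LimitTheory.

End GeneralizedLimit.
Section InvariantMeasure.
Local Open Scope classical_set_scope.
Variables (R : realType) (alpha : R) (h1 h0 : local_rule) (f : transition R).
Hypothesis alpha01 : 0 <= alpha <= 1.
Hypothesis fE : forall x y z b, f x y z [set b] =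
  (alpha * (h1 x y z == b)%:R + (1 - alpha) * (h0 x y z == b)%:R)%:E.
Variable x0 : int -> bool.
Implicit Types (M : ((int -> bool) -> R) -> R) (phi psi : (int -> bool) -> R).
Implicit Types (A B : set (int -> bool)).

Definition window (N : nat) : seq int := cells (- N%:Z) (N + N).+1.

Definition window_state (N t : nat) phi : R := state alpha h1 h0 (window N) x0 t phi.

(** Window and time horizon grow together, so a single limit both frees the coins outside the window
    and produces stationarity. *)
Definition cesaro (N : nat) phi : R :=
  N.+1%:R^-1 * \sum_(t < N.+1) window_state N t phi.

Let is_mean_window N t : is_mean (window_state N t).
Proof. exact: is_mean_state. Qed.

Lemma is_mean_cesaro N : is_mean (cesaro N).
Proof.
split=> [a phi psi|phi phi0|].
- rewrite /cesaro; under eq_bigr => t _ do rewrite (mean_linear (is_mean_window N t)).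
  by rewrite big_split /= -mulr_sumr; ring.
- rewrite mulr_ge0 ?invr_ge0 ?ler0n // sumr_ge0 // => t _.
  exact: (mean_ge0 (is_mean_window N t)).
- rewrite /cesaro; under eq_bigr => t _ do rewrite (mean1 (is_mean_window N t)).
  by rewrite sumr_const card_ord mulVf // pnatr_eq0.
Qed.

Let mean_indic01 M A : is_mean M -> 0 <= M \1_A <= 1.
Proof.
move=> hM; rewrite (mean_ge0 hM) => [|x]; last by rewrite indicE ler0n.
by rewrite -[leRHS](mean1 hM); apply: (mean_le hM) => x; rewrite indicE lern1 leq_b1.
Qed.

(** The difference telescopes to two boundary terms in [0, 1], divided by [N.+1]. *)
Lemma cesaro_evolve N A :
  `|cesaro N (evolve alpha h1 h0 (window N) \1_A) - cesaro N \1_A| <= N.+1%:R^-1.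
Proof.
rewrite /cesaro -mulrBr -sumrB normrM ger0_norm ?invr_ge0 ?ler0n //.
rewrite ler_piMr ?invr_ge0 ?ler0n //.
under eq_bigr => t _ do rewrite /window_state -stateS -/(window_state _ _ _).
rewrite -(big_mkord xpredT (fun t => window_state N t.+1 \1_A - window_state N t \1_A)).
rewrite telescope_sumr //.
have := mean_indic01 A (is_mean_window N N.+1).
have := mean_indic01 A (is_mean_window N 0).
rewrite ler_norml; lra.
Qed.

Definition rule_prob (x : int -> bool) (k : int) (b : bool) : R :=
  alpha * (h1 (x (k - 1)) (x k) (x (k + 1)) == b)%:R +
  (1 - alpha) * (h0 (x (k - 1)) (x k) (x (k + 1)) == b)%:R.

Lemma evolve_cylinder N (K : {fset int}) (y : int -> bool) x :
  {subset K <= window N} ->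
  evolve alpha h1 h0 (window N) \1_(cylinder K y) x = \prod_(k <- K) rule_prob x k (y k).
Proof.
move=> KN; rewrite /evolve.
pose g k b : R := ((if b then h1 else h0) (x (k - 1)) (x k) (x (k + 1)) == y k)%:R.
have -> : (fun w => \1_(cylinder K y) (step h1 h0 w x)) =
    fun w => \prod_(k <- K) g k (w k).
  apply/funext => w; rewrite indicE.
  have [/set_mem cK|nc] := boolP (_ \in _).
    by rewrite big1_seq // => k /andP[_ /cK]; rewrite /g /step => ->; rewrite eqxx.
  have /existsNP[k /not_implyP[kK /eqP nk]] : ~ cylinder K y (step h1 h0 w x).
    by move=> cK; move/negP: nc; apply; apply: mem_set.
  by rewrite (bigD1_seq k) ?fset_uniq //= /g (negbTE nk) mul0r.
rewrite coin_mean_prod ?fset_uniq //; apply: eq_big_seq => k /KN ->; by [].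
Qed.

Lemma extend_val (K : {fset int}) (x : int -> bool) k : k \in K ->
  extend [ffun i : K => x (val i)] k = x k.
Proof. by move=> kK; rewrite /extend insubT ffunE. Qed.

Lemma sum_cylinders (K : {fset int}) (F : (int -> bool) -> R) x :
  \sum_(z : {ffun K -> bool}) F (extend z) * \1_(cylinder K (extend z)) x =
  F (extend [ffun i : K => x (val i)]).
Proof.
rewrite (bigD1 [ffun i : K => x (val i)]) //= indicE mem_set ?mulr1; last first.
  by move=> k kK; rewrite extend_val.
rewrite big1 ?addr0 // => z zx; rewrite indicE memNset ?mulr0 // => h.
case/eqP: zx; apply/ffunP => i; rewrite ffunE h ?fsvalP //.
by rewrite /extend valK.
Qed.

Lemma mem_enlarge (K : {fset int}) k : k \in K ->
  [/\ k - 1 \in enlarge K, k \in enlarge K & k + 1 \in enlarge K].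
Proof.
move=> kK; split; apply/imfset2P.
- by exists (-1); [rewrite !inE|exists k; rewrite // addrC].
- by exists 0; [rewrite !inE|exists k; rewrite // add0r].
- by exists 1; [rewrite !inE|exists k; rewrite // addrC].
Qed.

(** The set function [m] comes along with [pi] because its last two clauses carry bounds that are
    uniform in the window and in time over to the invariant measure. *)
Theorem invariant_measure_exists :
  exists pi : probability (config int) R, invariant_measure f pi /\
  exists m : set (int -> bool) -> R,
  [/\ forall A B, A `&` B = set0 -> m (A `|` B) = m A + m B,
      forall K y, pi (cylinder K y) = (m (cylinder K y))%:E,
      forall A c, (forall N t, window_state N t \1_A <= c) -> m A <= c &
      forall A c, (forall N t, c <= window_state N t \1_A) -> c <= m A].
Proof.
have [L hL] := limit_functional_exists R.
have bdd (u : nat -> R) : (forall n, 0 <= u n <= 1) -> bounded_seq u.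
  by move=> u01; exists 1 => n; have /andP[u0 u1] := u01 n; rewrite ger0_norm.
have bc c : bounded_seq (fun=> c : R) by exists `|c|.
have bA A : bounded_seq (fun N => cesaro N \1_A).
  by apply: bdd => N; apply: mean_indic01; apply: is_mean_cesaro.
pose m A := L (fun N => cesaro N \1_A).
have cesaro_le N A c : (forall t, window_state N t \1_A <= c) -> cesaro N \1_A <= c.
  move=> h; rewrite /cesaro ler_pdivrMl ?ltr0n // mulr_natl.
  rewrite -[N.+1 in leRHS]card_ord -sumr_const.
  exact: ler_sum.
have cesaro_ge N A c : (forall t, c <= window_state N t \1_A) -> c <= cesaro N \1_A.
  move=> h; rewrite /cesaro ler_pdivlMl ?ltr0n // mulr_natl.
  rewrite -[N.+1 in leLHS]card_ord -sumr_const.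
  exact: ler_sum.
have m_add A B : A `&` B = set0 -> m (A `|` B) = m A + m B.
  move=> AB; rewrite /m -[L (fun N => cesaro N \1_A)]mul1r -(limit_linear hL) //.
  congr L; apply/funext => N; rewrite -(mean_linear (is_mean_cesaro N)).
  congr cesaro; apply/funext => x; rewrite mul1r !indicE in_setU.
  have [xA|] := boolP (x \in A); have [xB|] //= := boolP (x \in B); rewrite ?addr0 ?add0r //.
  by exfalso; have : (A `&` B) x; [split; exact: set_mem | rewrite AB].
have m_le A c : (forall N t, window_state N t \1_A <= c) -> m A <= c.
  move=> h; rewrite -[leRHS](limit_cst hL); apply: (limit_le hL) => //.
  by apply: nearW => N; apply: cesaro_le.
have m_ge A c : (forall N t, c <= window_state N t \1_A) -> c <= m A.
  move=> h; rewrite -[leLHS](limit_cst hL); apply: (limit_le hL) => //.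
  by apply: nearW => N; apply: cesaro_ge.
have m0 A : 0 <= m A.
  by apply: m_ge => N t; have /andP[] := mean_indic01 A (is_mean_window N t).
have m1 : m setT = 1.
  apply/eqP; rewrite eq_le; apply/andP; split; [apply: m_le => N t|apply: m_ge => N t];
    by rewrite indicT (mean1 (is_mean_window N t)).
have [pi piE] := cylinder_extension m0 m1 m_add.
exists pi; split; last by exists m.
move=> K y; rewrite piE /=.
under eq_bigr => z _.
  under eq_bigr => k _ do rewrite fE -/(rule_prob _ _ _).
  rewrite prodEFin piE -EFinM mulrC.
  over.
rewrite sumEFin; congr (_%:E).
pose a z := \prod_(k <- K) rule_prob z k (y k).
(* By linearity the image formula is the limit of averages of one-step expectations. It remains to
   compare them with the averages of the cylinder itself. *)
have [bS LS] := limit_sum hL (index_enum {ffun enlarge K -> bool})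
  (fun z => a (extend z)) (fun z => bA (cylinder (enlarge K) (extend z))).
rewrite -[RHS]LS; apply: limit_squeeze => //.
(* Once the window contains [K], all coins that matter are random and the finite dynamics has the
   exact one-step law on [K]. *)
near=> N; have KN : {subset K <= window N}.
  have NK : (\max_(k <- K) `|k|%N <= N)%N by near: N; exact: nbhs_infty_ge.
  move=> k kK; have : (`|k|%N <= N)%N by apply: leq_trans NK; exact: leq_bigmax_seq.
  by rewrite mem_cells; clear; lia.
rewrite distrC; apply: le_trans (cesaro_evolve N (cylinder K y)).
rewrite -(mean_sum (is_mean_cesaro N)).
rewrite le_eqVlt; apply/orP; left; apply/eqP; congr (`|cesaro _ _ - _|).
apply/funext => x; rewrite sum_cylinders evolve_cylinder //; apply: eq_big_seq => k kK.
have [k1 k2 k3] := mem_enlarge kK.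
by rewrite /rule_prob !extend_val.
Unshelve. all: by end_near. Qed.

End InvariantMeasure.
(** * A lower bound on the percolation threshold *)

Section PercolationThreshold.
Local Open Scope classical_set_scope.
Variable R : realType.

Fixpoint path_arcs (v : seq bool) (x : nat * nat) : seq grid_arc :=
  if v is b :: v' then (x, b) :: path_arcs v' (target (x, b)) else [::].

(** Every arc raises the sum of the coordinates by one, so a directed path never repeats an arc and
    its arcs are independent. *)
Lemma path_arcs_level v x e : e \in path_arcs v x -> (x.1 + x.2 <= e.1.1 + e.1.2)%N.
Proof.
elim: v x => [|b v IHv] x //=; rewrite in_cons => /orP[/eqP -> //|/IHv].
by case: x b => i j [] /=; lia.
Qed.

Lemma path_arcs_uniq v x : uniq (path_arcs v x).
Proof.
elim: v x => [|b v IHv] x //=; rewrite IHv andbT; apply/negP => /path_arcs_level.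
by case: x b => i j [] /=; lia.
Qed.

Lemma size_path_arcs v x : size (path_arcs v x) = size v.
Proof. by elim: v x => //= b v IHv x; rewrite IHv. Qed.

Definition open_arcs (l : seq grid_arc) : set (config grid_arc) :=
  [set w | all (w : grid_arc -> bool) l].

Lemma open_arcs_cylinder l : open_arcs l = cylinder [fset e in l]%fset (fun=> true).
Proof.
apply/seteqP; split=> w /=; first by move=> /allP h e; rewrite !inE => /h.
by move=> h; apply/allP => e el; apply: h; rewrite inE.
Qed.

Lemma measurable_cylinder (I : choiceType) (K : {fset I}) (y : I -> bool) :
  measurable (cylinder K y : set (config I)).
Proof. by apply: sub_sigma_algebra; exists K, y. Qed.

Lemma measurable_open_arcs l : measurable (open_arcs l).
Proof. by rewrite open_arcs_cylinder; exact: measurable_cylinder. Qed.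

Lemma open_arcs_prob (p : R) (mu : probability (config grid_arc) R) v x :
  0 <= p <= 1 -> iid_bernoulli p mu ->
  mu (open_arcs (path_arcs v x)) = (p ^+ size v)%:E.
Proof.
move=> p01 hmu; rewrite open_arcs_cylinder hmu.
have e1 : bernoulli_prob p [set true] = p%:E.
  rewrite bernoulli_probE // !diracE mem_set // memNset; last by case.
  by rewrite mule1 mule0 adde0.
under eq_bigr do rewrite e1.
rewrite prodEFin; congr (_%:E); rewrite big_const_seq count_predT.
rewrite -(size_path_arcs v x) -Monoid.iteropE /=.
rewrite (perm_size (uniq_perm (fset_uniq _) (path_arcs_uniq v x) _)) // => e.
by rewrite !inE.
Qed.

Definition open_paths (n : nat) : set (config grid_arc) :=
  [set w | exists2 v, size v = n & open_arcs (path_arcs v (0%N, 0%N)) w].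

(** Union bound over the [2 ^ n] direction words of length [n]. *)
Lemma open_paths_prob (p : R) (mu : probability (config grid_arc) R) n :
  0 <= p <= 1 -> iid_bernoulli p mu ->
  measurable (open_paths n) /\ (mu (open_paths n) <= ((2 * p) ^+ n)%:E)%E.
Proof.
move=> p01 hmu.
pose U (l : seq (n.-tuple bool)) : set (config grid_arc) :=
  [set w | exists2 v, v \in l & open_arcs (path_arcs v (0%N, 0%N)) w].
have hU l : measurable (U l) /\ (mu (U l) <= (p ^+ n *+ size l)%:E)%E.
  elim: l => [|v l [mU leU]].
    have -> : U [::] = set0 by apply/seteqP; split=> w // [].
    by rewrite measure0 /= mulr0n.
  have -> : U (v :: l) = open_arcs (path_arcs v (0%N, 0%N)) `|` U l.
    apply/seteqP; split=> w.
      move=> [v']; rewrite in_cons => /orP[/eqP ->|v'l] h; first by left.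
      by right; exists v'.
    move=> [h|[v' v'l h]]; first by exists v => //; rewrite mem_head.
    by exists v' => //; rewrite in_cons v'l orbT.
  have mv := measurable_open_arcs (path_arcs v (0%N, 0%N)).
  split; first exact: measurableU.
  apply: le_trans (measureU2 _ mv mU) _.
  rewrite /= mulrS EFinD leeD //.
  have := @open_arcs_prob p mu v (0%N, 0%N) p01 hmu; rewrite size_tuple => ->.
  exact: lexx.
have -> : open_paths n = U (enum {: n.-tuple bool}).
  apply/seteqP; split=> w [v].
    by move=> /eqP vn h; exists (Tuple vn) => //; rewrite mem_enum.
  by move=> _ h; exists v => //; rewrite size_tuple.
have [mU leU] := hU (enum {: n.-tuple bool}); split=> //.
apply: le_trans leU _; rewrite -cardE card_tuple card_bool lee_fin.
by rewrite exprMn -mulr_natl natrX.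
Qed.

Lemma infinite_path_open n w : infinite_open_path w -> open_paths n w.
Proof.
move=> [gamma [g0 hg]].
suff [v vn hv] : exists2 v, size v = n & open_arcs (path_arcs v (gamma 0%N)) w.
  by exists v => //; rewrite -g0.
elim: n 0%N => [|n IHn] k; first by exists [::].
have [v vn hv] := IHn k.+1; have [b [wb gE]] := hg k.
rewrite gE in hv; exists (b :: v); first by rewrite /= vn.
by apply/andP.
Qed.

Lemma subcritical (p : R) : 0 <= p < 1 / 2 -> no_percolation p.
Proof.
move=> /andP[p0 p2] mu hmu; have p01 : 0 <= p <= 1 by lra.
pose A := \bigcap_n open_paths n.
have mA : measurable A.
  by apply: bigcap_measurable => // n _; have [] := open_paths_prob n p01 hmu.
exists A; split=> //; last first.
  move=> w /= /contrapT h n _; exact: infinite_path_open.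
have fA : mu A \is a fin_num by exact: fin_num_measure.
apply/eqP; rewrite eq_le measure_ge0 andbT -(fineK fA) lee_fin.
have cv : (2 * p) ^+ n @[n --> \oo] --> (0 : R).
  by apply: cvg_expr; rewrite ger0_norm; lra.
rewrite -(cvg_lim (@Rhausdorff R) cv); apply: limr_ge; first by apply/cvg_ex; exists 0.
apply: nearW => n; rewrite -lee_fin fineK //.
have [mn le_n] := open_paths_prob n p01 hmu; apply: le_trans le_n.
by apply: le_measure; rewrite ?inE //; apply: bigcap_inf.
Qed.

Lemma pc_ge_half : 1 / 2 <= pc R <= 1.
Proof.
have ub : ubound [set p | 0 <= p <= 1 /\ @no_percolation R p] 1 by move=> p [/andP[]].
have in0 p : 0 <= p < 1 / 2 -> [set p | 0 <= p <= 1 /\ @no_percolation R p] p.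
  by move=> hp; split; [lra | exact: subcritical].
apply/andP; split; last first.
  by apply: sup_le_ub => //; exists 0; apply: in0; lra.
rewrite leNgt; apply/negP => h.
have pc0 : 0 <= pc R by apply: ub_le_sup; [exists 1 | apply: in0; lra].
(* If [pc] were below 1/2, the midpoint would be subcritical and yet exceed the supremum. *)
have : (pc R + 1 / 2) / 2 <= pc R by apply: ub_le_sup; [exists 1 | apply: in0; lra].
lra.
Qed.

End PercolationThreshold.
(** * Majority and FINAE *)

Definition alternating (k : int) : bool := odd `|k|%N.

Lemma alternatingS k : alternating (k + 1) = ~~ alternating k.
Proof. by rewrite /alternating; lia. Qed.

Lemma alternatingB k : alternating (k - 1) = ~~ alternating k.
Proof. by rewrite -[in RHS](subrK 1 k) alternatingS negbK. Qed.

Definition twist (x : int -> bool) : int -> bool := fun k => x k (+) alternating k.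

Definition negate (x : int -> bool) : int -> bool := fun k => ~~ x k.

Definition invert : local_rule := fun _ y _ => ~~ y.

Lemma iter_negate t x k : iter t negate x k = x k (+) odd t.
Proof. by elim: t => [|t IHt]; rewrite ?addbF // iterS /negate IHt -addbN. Qed.

Local Notation flip := flip_if_not_all_equal.

Lemma step_negate w x : step flip keep w (negate x) = negate (step flip keep w x).
Proof.
apply/funext => k; rewrite /step /negate /keep /flip.
by case: (w k) (x _) (x _) (x _) => -[] [] [].
Qed.

(** Relative to the parity of the central cell, the two neighbours appear negated, and the majority
    of [~~ l], [y], [~~ r] is [~~ y] exactly when [l = y = r]. *)
Lemma step_twist w x :
  step maj invert w (twist x) = twist (negate (step flip keep w x)).
Proof.
apply/funext => k; rewrite /step /twist /negate alternatingS alternatingB.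
by case: (w k) (x (k - 1)) (x k) (x (k + 1)) (alternating k) => -[] [] [] [].
Qed.

Section Twist.
Variables (R : realType) (alpha : R).
Implicit Types phi : (int -> bool) -> R.

Lemma evolve_negate W phi x :
  evolve alpha flip keep W phi (negate x) =
  evolve alpha flip keep W (fun y => phi (negate y)) x.
Proof. by rewrite /evolve; congr coin_mean; apply/funext => w; rewrite step_negate. Qed.

Lemma evolve_iter_negate W phi t x :
  evolve alpha flip keep W phi (iter t negate x) =
  evolve alpha flip keep W (fun y => phi (iter t negate y)) x.
Proof.
elim: t phi => [|t IHt] phi //; rewrite iterS evolve_negate IHt.
by congr evolve; apply/funext => y; rewrite iterS.
Qed.

(** Negation commutes with FINAE, so the global flips of the [t] steps can be collected at the
    end. *)
Lemma state_twist W x0 t phi :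
  state alpha maj invert W (twist x0) t phi =
  state alpha flip keep W x0 t (fun x => phi (twist (iter t negate x))).
Proof.
elim: t phi => [|t IHt] phi //; rewrite !stateS IHt; congr state.
apply/funext => x; rewrite -(evolve_iter_negate W (fun y => phi (twist (negate y)))).
by rewrite /evolve; congr coin_mean; apply/funext => w; rewrite step_twist.
Qed.

Lemma state_constant W b t phi :
  state alpha flip keep W (fun=> b) t phi = phi (fun=> b).
Proof.
elim: t phi => [|t IHt] phi //; rewrite stateS IHt /evolve.
rewrite -[RHS](coin_mean_cst alpha W); congr coin_mean; apply/funext => w; congr phi.
by apply/funext => k; rewrite /step; case: (w k); rewrite // /flip !eqxx.
Qed.

End Twist.

(** * Invariant measures of the two automata *)

Section Consequences.
Local Open Scope classical_set_scope.
Variables (R : realType) (alpha : {i01 R}).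
Hypothesis alpha_ge : 44 / 45 <= alpha%:num.

Let alpha01 : 0 <= alpha%:num <= 1.
Proof. by rewrite ge0 le1. Qed.

Definition five_cells : {fset int} := [fset k in cells 0 5]%fset.

Lemma mem_five_cells k : (k \in five_cells) = (0 <= k < 5).
Proof. by rewrite /five_cells !inE; apply: etrans (mem_cells 0 5 k) _; lia. Qed.

(** Five equal cells contain a dead run of three. Its term in the generating function gives
    [4 * run_bound t 3 <= 3 / 2]. The value 3/8 is useful because its double is below 1. *)
Lemma state_block W t c :
  state alpha%:num flip keep W alternating t \1_(cylinder five_cells (fun=> c)) <= 3 / 8.
Proof.
have e0 : 0 <= 1 - alpha%:num by move: alpha01; lra.
have e1 : 1 - alpha%:num <= 1 / 45 by move: alpha_ge; lra.
have alive k : ~~ dead c alternating k.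
  by rewrite /dead alternatingB; case: (alternating k) c => -[].
apply: (@le_trans _ _ (run_bound (1 - alpha%:num) t 3)).
  have := @state_dead_family R alpha%:num c alpha01 W alternating t
    [:: (1, 3%N)] alive isT.
  rewrite big_seq1 => /(le_trans _); apply.
  apply: (mean_le (is_mean_state _ _ alpha01 _ _ _)) => x; rewrite indicE.
  have [/set_mem xc|_] := boolP (_ \in _); last by rewrite ler0n.
  have xk k : 0 <= k < 5 -> x k = c by move=> k5; apply: xc; rewrite mem_five_cells.
  by rewrite /dead_family /= /dead_run /= /dead !xk // !eqxx.
have := psum_run_bound e0 e1 t 3.
have r0 n := run_bound_ge0 e0 t n.
rewrite /psum !big_ord_recl big_ord0 /= => h; have := r0 1%N; have := r0 2%N; lra.
Qed.

Lemma FINAE_rule x y z b : FINAE alpha x y z [set b] =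
  (alpha%:num * (flip x y z == b)%:R + (1 - alpha%:num) * (keep x y z == b)%:R)%:E.
Proof.
have e a : (a \in [set b]) = (a == b).
  by apply/idP/eqP => [/set_mem //|->]; apply: mem_set.
apply: etrans (mixtureE _ _ _ _) _; rewrite [RHS]EFinD !EFinM.
by congr (_ * _ + _ * _)%E; apply: etrans (diracE _ _ _) _; rewrite e.
Qed.

Lemma Majority_rule x y z b : Majority alpha x y z [set b] =
  (alpha%:num * (maj x y z == b)%:R + (1 - alpha%:num) * (invert x y z == b)%:R)%:E.
Proof.
have e a : (a \in [set b]) = (a == b).
  by apply/idP/eqP => [/set_mem //|->]; apply: mem_set.
apply: etrans (mixtureE _ _ _ _) _; rewrite [RHS]EFinD !EFinM.
by congr (_ * _ + _ * _)%E; apply: etrans (diracE _ _ _) _; rewrite e.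
Qed.

(** A mixture of the two monochromatic masses gives total mass 1 to the two events of five equal
    cells; the measure obtained from the alternating start gives them at most 3/4. *)
Lemma FINAE_nontrivial : nontrivial_invariant_measure (FINAE alpha).
Proof.
have [pi [inv [m [_ piE m_le _]]]] :=
  invariant_measure_exists alpha01 FINAE_rule alternating.
exists pi => // -[t piM].
have le c : (pi (cylinder five_cells (fun=> c)) <= (3 / 8)%:E)%E.
  by rewrite piE lee_fin; apply: m_le => N s; apply: state_block.
have val c : pi (cylinder five_cells (fun=> c)) =
    (t%:num * (~~ c)%:R + (1 - t%:num) * c%:R)%:E.
  rewrite piM; last exact: measurable_cylinder.
  have e b : (monochromatic b \in cylinder five_cells (fun=> c)) = (b == c).
    apply/idP/eqP => [/set_mem/(_ 0)|-> ]; last exact: mem_set.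
    by apply; rewrite mem_five_cells.
  apply: etrans (mixtureE _ _ _ _) _; rewrite [RHS]EFinD !EFinM.
  by congr (_ * _ + _ * _)%E; apply: etrans (diracE _ _ _) _; rewrite e; case: (c).
have := le true; have := le false; rewrite !val !lee_fin /=; lra.
Qed.

(** In twisted coordinates the alternating start is constant, so Majority merely exchanges the two
    checkerboards and the two events [alt] have total mass 1 under [pi1]. The zero start is the
    twist of the alternating one, and the two events have mass at most 3/4 under [pi2]. *)
Lemma Majority_several : several_invariant_measures (Majority alpha).
Proof.
pose alt c := cylinder five_cells (fun k => c (+) alternating k).
have [pi1 [inv1 [m1 [add1 pi1E _ m1_ge]]]] :=
  invariant_measure_exists alpha01 Majority_rule alternating.
have [pi2 [inv2 [m2 [_ pi2E m2_le _]]]] :=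
  invariant_measure_exists alpha01 Majority_rule (fun=> false).
exists pi1, pi2; split=> //.
have le c : (pi2 (alt c) <= (3 / 8)%:E)%E.
  rewrite pi2E lee_fin; apply: m2_le => N t.
  have -> : (fun=> false) = twist alternating by apply/funext => k; rewrite /twist addbb.
  (* The [t] accumulated flips exchange the two colours of the block when [t] is odd. *)
  rewrite /window_state state_twist; apply: le_trans (state_block (window N) t (c (+) odd t)).
  rewrite le_eqVlt; apply/orP; left; apply/eqP; congr state; apply/funext => x.
  rewrite !indicE; congr (_%:R).
  apply: (congr1 nat_of_bool); apply/idP/idP => /set_mem h; apply: mem_set => k /h;
    rewrite /twist iter_negate.
  - by case: (x k) (alternating k) c (odd t) {h} => -[] [] [].
  - by case: (x k) (alternating k) c (odd t) {h} => -[] [] [].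
have ge : (1 <= pi1 (alt false) + pi1 (alt true))%E.
  rewrite !pi1E -EFinD -add1; last first.
    apply/seteqP; split=> // x [/(_ 0) h0 /(_ 0) h1].
    by rewrite h1 mem_five_cells // in h0; have := h0 isT.
  rewrite lee_fin; apply: m1_ge => N t.
  have {1}-> : alternating = twist (fun=> false) by [].
  rewrite /window_state state_twist state_constant indicE mem_set //.
  rewrite /twist; case ot: (odd t); [right|left] => k _; by rewrite iter_negate ot.
have [e0|n0] := pselect (pi1 (alt false) = pi2 (alt false)); last first.
  by exists (alt false) => //; exact: measurable_cylinder.
exists (alt true); first exact: measurable_cylinder.
move=> e1; have := le true; have := le false; move: ge.
rewrite e0 e1 !pi2E -EFinD !lee_fin; lra.
Qed.

End Consequences.

(** From [1 / 2 <= pc] one gets [15 / 16 <= a ^+ 3], while [(44 / 45) ^+ 3] is about 0.935, just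
    below 0.9375. *)
Lemma percolation_threshold_bound (R : realType) (a : R) : 0 <= a ->
  (1 - (1 - pc R) ^+ 4) `^ (3^-1) <= a -> 44 / 45 <= a.
Proof.
move=> a0 h; have /andP[lo hi] := pc_ge_half R.
set X := 1 - _ in h.
have X_ge : 15 / 16 <= X.
  have : (1 - pc R) ^+ 4 <= (1 / 2) ^+ 4 by apply: lerXn2r; rewrite ?nnegrE; lra.
  rewrite /X; lra.
have Xa : X <= a ^+ 3.
  have -> : X = (X `^ (3^-1)) ^+ 3.
    rewrite -powR_mulrn ?powR_ge0 // -powRrM mulVf // powRr1 //; lra.
  by apply: lerXn2r; rewrite ?nnegrE ?powR_ge0.
rewrite leNgt; apply/negP => a_lt.
have : a ^+ 3 <= (44 / 45) ^+ 3 by apply: lerXn2r; rewrite ?nnegrE; lra.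
lra.
Qed.

Theorem proposition5p3 (R : realType) (alpha : {i01 R})
    (halpha : 0 < alpha%:num < 1) :
  ((1 - (1 - pc R) ^+ 4) `^ (3^-1) <= alpha%:num ->
     several_invariant_measures (Majority alpha) /\
     nontrivial_invariant_measure (FINAE alpha)) /\
  (996 / 1000 <= alpha%:num ->
     several_invariant_measures (Majority alpha) /\
     nontrivial_invariant_measure (FINAE alpha)).
Proof.
have main : 44 / 45 <= alpha%:num -> several_invariant_measures (Majority alpha) /\
     nontrivial_invariant_measure (FINAE alpha).
  by move=> h; split; [exact: Majority_several | exact: FINAE_nontrivial].
split=> h; apply: main.
- by apply: percolation_threshold_bound h; case/andP: halpha => /ltW.
- lra.
Qed.
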